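(* For each integer $k\ge1$, every $k$-thin graph has boxicity at most $k$.
   Context: A graph $G=(V,E)$ is $k$-thin if its vertices admit a linear ordering $v_1<\dots<v_n$ and a partition $V=V^1\uplus\dots\uplus V^k$ such that for all $a<b<c$ with $v_a,v_b$ in the same part $V^i$ and $\{v_a,v_c\}\in E$, also $\{v_b,v_c\}\in E$. A graph has boxicity at most $k$ if it is the intersection graph of a family of axis-parallel boxes in $\mathbb{R}^k$ (one box per vertex, adjacency iff the boxes intersect). *)

(* Defs.v *)
From HB Require Import structures.
From mathcomp Require Import all_boot all_order all_algebra.
From mathcomp Require Import boolp classical_sets reals.

Set Implicit Arguments.
Unset Strict Implicit.
Unset Printing Implicit Defensive.

Import Order.TTheory GRing.Theory Num.Theory.
Local Open Scope ring_scope.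
Local Open Scope classical_set_scope.

Definition simple_graph (V : finType) (e : rel V) : Prop :=
  symmetric e /\ irreflexive e.

(* [v] enumerates the vertices in increasing order, and [p x] is the index of
   the part containing [x]; parts are allowed to be empty. *)
Definition thin (V : finType) (e : rel V) (k : nat) : Prop :=
  exists (v : 'I_#|V| -> V) (p : V -> 'I_k),
    bijective v /\
    forall a b c : 'I_#|V|,
      (a < b)%N -> (b < c)%N -> p (v a) = p (v b) -> e (v a) (v c) ->
      e (v b) (v c).

Section Boxicity.
Variable R : realType.

Definition is_box (k : nat) (B : set 'rV[R]_k) : Prop :=
  exists l u : 'rV[R]_k,
    (forall i, l ord0 i <= u ord0 i) /\
    B = [set x : 'rV[R]_k | forall i, l ord0 i <= x ord0 i <= u ord0 i].

(* Adjacency is only compared on distinct vertices, since a nonempty box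
   always meets itself. *)
Definition boxicity_le (V : finType) (e : rel V) (k : nat) : Prop :=
  exists B : V -> set 'rV[R]_k,
    (forall x, is_box (B x)) /\
    forall x y : V, x <> y -> (e x y <-> B x `&` B y !=set0).

End Boxicity.

(* Main.v *)
Require Import Defs.
From HB Require Import structures.
From mathcomp Require Import all_boot all_order all_algebra.
From mathcomp Require Import boolp classical_sets reals.

(** Order the vertices by position. For a part [i], the non-neighbours of [y]
    that precede [y] and lie in part [i] form an initial segment of the vertices
    of part [i] preceding [y]; let [f i y] be the position just after that
    segment. In coordinate [i] give [y] the interval from [f i y] to the position
    of [y] if [y] is in part [i], and to a common upper bound otherwise. For [x]
    before [y], these intervals can only be disjoint when [x] is in part [i], and
    then they meet iff [f i y] is at most the position of [x], i.e. iff [x] and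
    [y] are adjacent. *)

Set Implicit Arguments.
Unset Strict Implicit.
Unset Printing Implicit Defensive.

Import Order.TTheory GRing.Theory Num.Theory.

Section Boxes.
Local Open Scope ring_scope.
Local Open Scope classical_set_scope.
Variables (R : realType) (k : nat).

Definition box (l u : 'rV[R]_k) : set 'rV[R]_k :=
  [set x | forall i, l ord0 i <= x ord0 i <= u ord0 i].

(** The coordinatewise maximum of the two lower corners serves as a common point. *)
Lemma box_meetP (l u l' u' : 'rV[R]_k) :
  (forall i, l ord0 i <= u ord0 i) -> (forall i, l' ord0 i <= u' ord0 i) ->
  (box l u `&` box l' u' !=set0) <->
  (forall i, (l ord0 i <= u' ord0 i) && (l' ord0 i <= u ord0 i)).
Proof.
move=> lu lu'; split=> [[x [bx bx']] i|meet].
  have /andP[lx xu] := bx i; have /andP[lx' xu'] := bx' i.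
  by rewrite (le_trans lx xu') (le_trans lx' xu).
exists (\row_i Num.max (l ord0 i) (l' ord0 i)).
by split=> i; have /andP[lui' l'ui] := meet i;
  rewrite mxE le_max ge_max lexx ?orbT /= ?lu ?lu' ?lui' ?l'ui.
Qed.

End Boxes.

Section LastNonNeighbour.
Variables (V : finType) (e : rel V) (k : nat) (g : V -> nat) (p : V -> 'I_k).

(* The [f i y] of the header; the empty maximum is 0. *)
Definition after_nonnbr (i : 'I_k) (y : V) : nat :=
  \max_(x | [&& g x < g y, p x == i & ~~ e x y]) (g x).+1.

Lemma after_nonnbr_le i y : after_nonnbr i y <= g y.
Proof. by apply/bigmax_leqP => x /andP[]. Qed.

Hypothesis g_inj : injective g.
Hypothesis g_thin : forall x y z : V,
  g x < g y -> g y < g z -> p x = p y -> e x z -> e y z.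

(** If [x] is not adjacent to [y], it enters the maximum itself and pushes it past [g x]. If it is
    adjacent, thinness makes every later vertex of its part that precedes [y] adjacent to [y], so
    only vertices before [x] enter. *)
Lemma after_nonnbr_leP x y : g x < g y -> (after_nonnbr (p x) y <= g x) = e x y.
Proof.
move=> xy; apply/idP/idP => [fx|exy].
  apply: contraTT fx => nexy; rewrite -ltnNge.
  by apply: (@leq_bigmax_cond _ _ (fun x => (g x).+1)); rewrite xy eqxx.
apply/bigmax_leqP => z /and3P[zy /eqP pz nezy].
rewrite ltnNge leq_eqVlt; apply/norP; split; apply: contraNN nezy.
  by move/eqP/g_inj <-.
by move=> xz; apply: g_thin exy.
Qed.

End LastNonNeighbour.

Theorem theorem14 (R : realType) (k : nat) (hk : (1 <= k)%N)
  (V : finType) (e : rel V) (hG : simple_graph e) :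
  thin e k -> boxicity_le R e k.
Proof.
case: hG => e_sym _ [v [p [[w vK wK] v_thin]]].
pose g x : nat := w x.
have g_inj : injective g by move=> x y /val_inj /(can_inj wK).
have g_thin x y z : g x < g y -> g y < g z -> p x = p y -> e x z -> e y z.
  by have := v_thin (w x) (w y) (w z); rewrite !wK.
pose f := after_nonnbr e g p.
pose h i y := if p y == i then g y else #|V|.
have g_le_h i y : g y <= h i y.
  by rewrite /h; case: ifP => // _; exact: ltnW (ltn_ord _).
have f_le_g i y : f i y <= g y by exact: after_nonnbr_le.
have f_le_h i y : f i y <= h i y := leq_trans (f_le_g i y) (g_le_h i y).
pose l y : 'rV[R]_k := (\row_i (f i y)%:R)%R.
pose u y : 'rV[R]_k := (\row_i (h i y)%:R)%R.
have lu y i : (l y ord0 i <= u y ord0 i)%R by rewrite !mxE ler_nat.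
exists (fun y => box (l y) (u y)); split=> [y|x y xy]; first by exists (l y), (u y).
have meetE z t : (box (l z) (u z) `&` box (l t) (u t) !=set0)%classic <->
    forall i, (f i z <= h i t) && (f i t <= h i z).
  by rewrite (box_meetP (lu z) (lu t)); split=> H i; have := H i; rewrite !mxE !ler_nat.
rewrite meetE => {meetE}.
wlog xy_lt : x y xy / g x < g y => [wlog_xy|].
  case: (ltngtP (g x) (g y)) => [|yx|/g_inj //]; first exact: wlog_xy.
  rewrite e_sym (wlog_xy y x) //; last by move=> yx'; apply: xy.
  by split=> H i; rewrite andbC.
have x_le_y i : f i x <= h i y.
  exact: leq_trans (f_le_g i x) (leq_trans (ltnW xy_lt) (g_le_h i y)).
(* What remains is [f i y <= h i x], automatic unless [i = p x], where [h i x] is [g x]. *)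
rewrite -(after_nonnbr_leP g_inj g_thin xy_lt); split=> [fx i|H].
  rewrite x_le_y /=; rewrite /h; case: eqP => [<- //|_].
  exact: leq_trans (f_le_g i y) (ltnW (ltn_ord _)).
by have /andP[_] := H (p x); rewrite /h eqxx.
Qed.
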